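(* Let $f=a_0+a_1z+\cdots+a_nz^n\in\mathbb{Z}[z]$ be a primitive polynomial with $a_0a_n\neq 0$, and let $\Delta_f$ be a positive integer as in the context. Suppose there exist natural numbers $m,d,k$ and a prime $p\nmid d$ with $(m-1-h_f)^{\Delta_f}\geq d$ such that $s_0(m)=\pm p^kd$. Then $f$ is a product of at most $$\min_{0\leq i\leq n}\{i+v_p(s_i(m))\}$$ irreducible factors in $\mathbb{Z}[z]$. In particular, if $k=1$ or $p\nmid s_1(m)$, then $f$ is irreducible in $\mathbb{Z}[z]$.
   Context: For $f=a_0+\cdots+a_nz^n$ with $a_n\neq0$, the height is $h_f=\max_{0\leq i\leq n-1}|a_i|/|a_n|$. For $i=0,\ldots,n$, $s_i(z)=f^{(i)}(z)/i!\in\mathbb{Z}[z]$, with $f^{(i)}$ the $i$-th formal derivative ($s_0=f$). $\Delta_f$ denotes a natural number with $\Delta_f\leq\deg f$ such that every nonconstant factor of $f$ in $\mathbb{Z}[z]$ has degree at least $\Delta_f$. Primitive means the gcd of coefficients is $1$. $v_p(a)$ is the exponent of the prime $p$ in the nonzero integer $a$, and $v_p(0)=\infty$.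
   Formalization: The formal statement adds the hypothesis m ≥ 1 + h_f (automatic for odd Δ_f); without it the claim fails for even Δ_f, e.g. f = z^4+z^2+1 = (z^2+z+1)(z^2−z+1), Δ_f = 2, m = d = k = 1, p = 3. *)

(* Defs.v *)
From HB Require Import structures.
From mathcomp Require Import all_boot all_order all_algebra.
From mathcomp Require Import constructive_ereal.

Set Implicit Arguments.
Unset Strict Implicit.
Unset Printing Implicit Defensive.

Import Order.TTheory GRing.Theory Num.Theory.
Local Open Scope ring_scope.

Definition primitive_poly (f : {poly int}) : Prop :=
  \big[gcdn/0%N]_(i < size f) absz f`_i = 1%N.

(* The initial value 0 of the maximum is harmless: the ratios are nonnegative. *)
Definition height (f : {poly int}) : rat :=
  \big[Num.max/0]_(i < (size f).-1) (`|f`_i|%:Q / `|lead_coef f|%:Q).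

(* Ring-theoretic irreducibility, so that in Z[z] a nonunit constant counts as
   a proper factor; [irreducible_poly] is the notion for coefficients in a
   field, where constants are ignored. *)
Definition irreducible_elt (A : unitRingType) (x : A) : Prop :=
  [/\ x != 0, x \isn't a GRing.unit &
      forall a b : A, x = a * b -> a \is a GRing.unit \/ b \is a GRing.unit].

(* Divisibility is spelled out because [%|] on {poly int} is pseudo-divisibility,
   i.e. divisibility over the rationals. *)
Definition factor_degree_bound (f : {poly int}) (D : nat) : Prop :=
  (D <= (size f).-1)%N /\
  forall g h : {poly int}, f = g * h -> (1 < size g)%N -> (D <= (size g).-1)%N.

Definition vp (p : nat) (a : int) : \bar int :=
  if a == 0 then +oo%E else ((logn p (absz a))%:Z)%:E.

Definition min_index_valuation (p : nat) (f : {poly int}) (m : nat) : \bar int :=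
  \big[Order.min/+oo%E]_(i < size f) ((i%:Z)%:E + vp p (f^`N(i)).[m%:Z])%E.

(* Main.v *)
Require Import Defs.
From Stdlib Require Import Classical.
From HB Require Import structures.
From mathcomp Require Import all_boot all_order all_algebra.
From mathcomp Require Import algC.
From mathcomp Require Import constructive_ereal.

Set Implicit Arguments.
Unset Strict Implicit.
Unset Printing Implicit Defensive.

Import Order.TTheory GRing.Theory Num.Theory.
Local Open Scope ring_scope.

(** If f = g h with g nonconstant, every complex root z of g is a root of f, so
    |z| < 1 + h_f by Cauchy's bound and |m - z| > m - 1 - h_f. This base is at
    least 1, because its D-th power is at least d and p does not divide d = 0.
    Hence |g(m)| > (m - 1 - h_f)^(deg g) >= (m - 1 - h_f)^D >= d. As g(m)
    divides p^k d, it cannot be prime to p. So in a factorization of f into r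
    irreducible (by primitivity, nonconstant) factors p divides the constant
    coefficient of each factor expanded around m, and p^(r - i) divides the
    i-th coefficient s_i(m) of the product. *)

Lemma absz_sgz (a : int) : absz (sgz a) = (a != 0).
Proof. by apply/eqP; rewrite -eqz_nat abszE normr_sgz. Qed.

Lemma unitzE (a : int) : (a \is a GRing.unit) = (absz a == 1%N).
Proof. by case: a => [[|[|n]]|[|n]]. Qed.

Lemma primitive_poly_zcontents_unit (f : {poly int}) :
  f != 0 -> primitive_poly f -> zcontents f \is a GRing.unit.
Proof.
move=> f0 prim; rewrite unitzE /zcontents abszM [X in (_ * X)%N]prim muln1.
by rewrite absz_sgz lead_coef_eq0 f0.
Qed.

(** A constant equals its signed content [zcontents], so a constant with unit content is a unit. *)
Lemma unitz_zcontents_size_gt1 (f : {poly int}) :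
  zcontents f \is a GRing.unit -> f \isn't a GRing.unit -> (1 < size f)%N.
Proof.
move=> uf; apply: contraR; rewrite -leqNgt => /size1_polyC fE.
move: uf; rewrite fE poly_unitE coefC eqxx /= /zcontents lead_coefC size_polyC.
have [->|c0] := eqVneq f`_0 0; first by rewrite sgz0 mul0r unitr0.
rewrite big_ord_recl big_ord0 /= coefC eqxx gcdn0 !unitzE.
by rewrite abszM absz_sgz c0 mul1n.
Qed.

(** Strong induction on the size. Since [zcontents] is multiplicative, both factors of a splitting
    into nonunits have unit content; hence they are nonconstant, and each has smaller degree than
    [f]. *)
Lemma primitive_factorization (f : {poly int}) :
  zcontents f \is a GRing.unit -> (1 < size f)%N ->
  exists gs : seq {poly int},
    (forall g, g \in gs -> irreducible_elt g /\ (1 < size g)%N) /\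
    f = \prod_(g <- gs) g.
Proof.
have [n] := ubnP (size f); elim: n f => // n IHn f.
rewrite ltnS => le_fn uf f_gt1.
have f_neq0 : f != 0 by rewrite -size_poly_gt0; exact: leq_trans f_gt1.
have nuf : f \isn't a GRing.unit by rewrite poly_unitE gtn_eqF.
have [irr_f | nirr_f] := classic (irreducible_elt f).
  exists [:: f]; rewrite big_seq1; split=> // g; rewrite inE => /eqP->.
  by split.
have [a [b [fab nua nub]]] : exists a b : {poly int},
    [/\ f = a * b, a \isn't a GRing.unit & b \isn't a GRing.unit].
  apply: NNPP => nex; apply: nirr_f; split=> // a b fab.
  have [?|nua] := boolP (a \is a GRing.unit); first by left.
  have [?|nub] := boolP (b \is a GRing.unit); first by right.
  by case: nex; exists a, b.
move: uf; rewrite fab zcontentsM unitrM => /andP[ua ub].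
have a_gt1 := unitz_zcontents_size_gt1 ua nua.
have b_gt1 := unitz_zcontents_size_gt1 ub nub.
have sf : size f = (size a + size b).-1.
  by rewrite fab size_mul // -size_poly_gt0 ltnW.
have sa : (size a < size f)%N.
  rewrite sf -(prednK (ltnW b_gt1)) addnS /= -[X in (X < _)%N]addn0.
  by rewrite ltn_add2l -ltnS prednK // ltnW.
have sb : (size b < size f)%N.
  rewrite sf -(prednK (ltnW a_gt1)) addSn /= -[X in (X < _)%N]add0n.
  by rewrite ltn_add2r -ltnS prednK // ltnW.
have [gs [irr_gs ->]] := IHn a (leq_trans sa le_fn) ua a_gt1.
have [hs [irr_hs ->]] := IHn b (leq_trans sb le_fn) ub b_gt1.
exists (gs ++ hs); rewrite big_cat; split=> // g.
by rewrite mem_cat => /orP[/irr_gs | /irr_hs].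
Qed.

(** Taylor expansion at [c]: both sides obey the same recursion along the Horner form of [f]. *)
Lemma coef_comp_XaddC (R : comNzRingType) (f : {poly R}) (c : R) (i : nat) :
  (f \Po ('X + c%:P))`_i = (f^`N(i)).[c].
Proof.
elim/poly_ind: f i => [|f a IHf] i.
  by rewrite comp_poly0 coef0 linear0 horner0.
rewrite comp_polyD comp_polyM comp_polyX comp_polyC mulrDr.
rewrite coefD coefD coefMX coefMC coefC.
case: i => [|i] /=.
  by rewrite !nderivn0 add0r IHf nderivn0 !hornerE mulrC.
by rewrite nderivnMXaddC !IHf !hornerE mulrC.
Qed.

(** Each term of the i-th coefficient takes a nonconstant coefficient from at most i factors, so at
    least [size gs - i] constant coefficients, each divisible by [p], remain. *)
Lemma coef_prod_dvdz (p : int) (gs : seq {poly int}) (i : nat) :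
  (forall g, g \in gs -> (p %| g`_0)%Z) ->
  (p ^+ (size gs - i) %| (\prod_(g <- gs) g)`_i)%Z.
Proof.
elim: gs i => [|g gs IHgs] i p_gs; first by rewrite sub0n expr0 dvd1z.
have {}IHgs j : (p ^+ (size gs - j) %| (\prod_(h <- gs) h)`_j)%Z.
  by apply: IHgs => h h_gs; apply: p_gs; rewrite inE h_gs orbT.
rewrite big_cons coefM; apply: rpred_sum => -[[|j] /= le_ji] _.
  have pg : (p %| g`_0)%Z by apply: p_gs; rewrite mem_head.
  rewrite subn0; apply: dvdz_trans (dvdz_mul pg (IHgs i)).
  by rewrite -exprS; apply: dvdz_exp2l; rewrite leq_subLR addnS ltnS -leq_subLR.
(* A nonconstant coefficient of [g] lowers the index left for the tail by at least 1, which makes up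
   for the power of [p] that [g] need not supply. *)
apply: dvdz_mull; apply: dvdz_trans (IHgs (i - j.+1)%N); apply: dvdz_exp2l.
rewrite ltnS in le_ji; rewrite subnBA // leq_sub2r // addnS ltnS leq_addr //.
Qed.

(** If |x| >= 1 + h, then h <= |x| - 1, and a geometric sum bounds the lower terms by |lc| (|x|^n -
    1), too small to cancel the leading term. *)
Lemma cauchy_root_bound (R : numFieldType) (q : {poly R}) (h x : R) :
  q != 0 -> 0 <= h ->
  (forall i, (i < (size q).-1)%N -> `|q`_i| <= h * `|lead_coef q|) ->
  root q x -> `|x| < 1 + h.
Proof.
move=> q0 h0 hq /rootP qx0; rewrite real_ltNge ?realE ?normr_ge0 ?addr_ge0 //.
apply/negP => le_hx; set n := (size q).-1 in hq.
have sq : size q = n.+1 by rewrite prednK // size_poly_gt0.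
have lc_gt0 : 0 < `|lead_coef q| by rewrite normr_gt0 lead_coef_eq0.
have h_le : h <= `|x| - 1 by rewrite lerBrDl.
move: qx0; rewrite horner_coef sq big_ord_recr /= => /eqP.
rewrite addrC addr_eq0 => /eqP/(congr1 Num.norm).
rewrite normrN normrM normrX -/(lead_coef q) => lcE.
have : `|lead_coef q| * `|x| ^+ n <= `|lead_coef q| * (`|x| ^+ n - 1).
  rewrite [X in X <= _](_ : _ = `|\sum_(i < n) q`_i * x ^+ i|) // subrX1.
  apply: le_trans (ler_norm_sum _ _ _) _; rewrite !mulr_sumr.
  apply: ler_sum => i _.
  rewrite normrM normrX !mulrA ler_wpM2r ?exprn_ge0 //.
  by apply: le_trans (hq i _) _ => //; rewrite mulrC ler_wpM2l.
by rewrite ler_pM2l // lerBrDl gerDr ler10.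
Qed.

(** Split [q] into linear factors: each |x - z| >= |x| - |z| exceeds [b], and the leading
    coefficient has modulus at least 1. *)
Lemma norm_horner_gt_exp (F : numClosedFieldType) (q : {poly F}) (b x : F) :
  (1 < size q)%N -> 1 <= `|lead_coef q| -> 0 <= b ->
  (forall z, root q z -> `|z| < `|x| - b) -> b ^+ (size q).-1 < `|q.[x]|.
Proof.
move=> q_gt1 lc_ge1 b_ge0 rt_q.
have lc0 : lead_coef q != 0 by rewrite -normr_gt0 (lt_le_trans ltr01).
have [s qE] := closed_field_poly_normal q.
have s_size : (size q).-1 = size s by rewrite qE size_scale // size_prod_XsubC.
have s_root z : z \in s -> root q z.
  by move=> zs; rewrite qE rootZ // root_prod_XsubC.
have -> : `|q.[x]| = `|lead_coef q| * \prod_(z <- s) `|x - z|.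
  rewrite {1}qE hornerZ normrM horner_prod normr_prod; congr (_ * _).
  by apply: eq_bigr => z _; rewrite !hornerE.
apply: lt_le_trans (ler_peMl _ lc_ge1); last by rewrite prodr_ge0.
have -> : b ^+ (size q).-1 = \prod_(z <- s) b.
  by rewrite big_const_seq iter_mulr_1 count_predT s_size.
(* Strictness requires at least one root, which exists because [q] is nonconstant. *)
rewrite !big_seq; apply: ltr_prod => [|z zs].
  case: s s_size {qE s_root} => [/eqP|z s _]; last by rewrite /= mem_head.
  by rewrite -subn1 subn_eq0 leqNgt q_gt1.
rewrite b_ge0 /= (lt_le_trans _ (lerB_dist _ _)) //.
by rewrite ltrBrDr addrC -ltrBrDr rt_q // s_root.
Qed.

Lemma height_ge0 (f : {poly int}) : 0 <= height f.
Proof. exact: bigmax_ge_id. Qed.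

Lemma coef_le_height (f : {poly int}) (i : nat) :
  f != 0 -> (i < (size f).-1)%N ->
  `|f`_i|%:Q <= height f * `|lead_coef f|%:Q.
Proof.
move=> f0 lt_i; rewrite -ler_pdivrMr ?ltr0z ?normr_gt0 ?lead_coef_eq0 //.
pose F (j : 'I_(size f).-1) := `|f`_j|%:Q / `|lead_coef f|%:Q.
exact: (le_bigmax _ F (Ordinal lt_i)).
Qed.

Lemma root_lt_height (f : {poly int}) (z : algC) :
  f != 0 -> root (map_poly intr f) z -> `|z| < 1 + ratr (height f).
Proof.
move=> f0; apply: cauchy_root_bound.
- by rewrite map_poly_eq0_id0 // intr_eq0 lead_coef_eq0.
- by rewrite ler0q height_ge0.
rewrite size_map_inj_poly //; last exact: intr_inj.
move=> i lt_i; rewrite lead_coef_map_inj //; last exact: intr_inj.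
rewrite coef_map /= -!intr_norm -!(ratr_int algC) -rmorphM ler_rat.
exact: coef_le_height.
Qed.

Lemma factor_horner_gt (f g h : {poly int}) (m : nat) :
  f != 0 -> f = g * h -> (1 < size g)%N -> 1 + height f <= m%:R ->
  (m%:R - 1 - height f) ^+ (size g).-1 < (absz g.[m%:Z])%:R.
Proof.
move=> f0 fgh g_gt1 m_ge.
have g0 : g != 0 by apply: contra_neq f0 => g0; rewrite fgh g0 mul0r.
(* The rational inequality is moved to [algC], where [g] splits. *)
rewrite -(ltr_rat algC) rmorphXn !rmorphB /= !ratr_nat rmorph1.
have size_gC : size (map_poly intr g : {poly algC}) = size g.
  by rewrite size_map_inj_poly //; exact: intr_inj.
have -> : (absz g.[m%:Z])%:R = `|(map_poly intr g).[m%:R]| :> algC.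
  by rewrite -[m%:R]/((m%:Z)%:~R) horner_map /= -intr_norm -abszE.
rewrite -{1}size_gC; apply: norm_horner_gt_exp; rewrite ?size_gC //.
- rewrite lead_coef_map_inj //; last exact: intr_inj.
  by rewrite norm_intr_ge1 ?intr_int // intr_eq0 lead_coef_eq0.
- rewrite -(ler_rat algC) rmorphD /= rmorph1 ratr_nat in m_ge.
  by rewrite -addrA -opprD subr_ge0.
move=> z gz; rewrite normr_nat -[X in _ - X]addrA -opprD subKr.
by apply: root_lt_height; rewrite // fgh rmorphM rootM gz.
Qed.

Lemma prime_dvd_factor_horner (f g h : {poly int}) (D m d k p : nat) :
  f != 0 -> (0 < D)%N -> factor_degree_bound f D ->
  prime p -> ~~ (p %| d)%N ->
  1 + height f <= m%:R -> d%:R <= (m%:R - 1 - height f) ^+ D ->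
  absz f.[m%:Z] = (p ^ k * d)%N ->
  f = g * h -> (1 < size g)%N -> (p%:Z %| g.[m%:Z])%Z.
Proof.
move=> f0 D_gt0 [_ D_le] p_pr p_d m_ge m_pow f_m fgh g_gt1.
have d_gt0 : (0 < d)%N by case: d p_d {m_pow f_m} => //; rewrite dvdn0.
have b_ge0 : 0 <= m%:R - 1 - height f by rewrite -addrA -opprD subr_ge0.
(* With base at least 1, the power does not decrease when the exponent grows from [D] to the degree
   of [g]. *)
have b_ge1 : 1 <= m%:R - 1 - height f.
  rewrite leNgt; apply/negP => b_lt1.
  have : (m%:R - 1 - height f) ^+ D < 1 by rewrite exprn_ilt1 // -lt0n.
  by rewrite ltNge (le_trans _ m_pow) // ler1n.
have d_lt : (d < absz g.[m%:Z])%N.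
  rewrite -(ltr_nat rat).
  apply: le_lt_trans (factor_horner_gt f0 fgh g_gt1 m_ge).
  by apply: le_trans m_pow _; rewrite ler_weXn2l // (D_le _ h).
(* If [p] did not divide g(m), then g(m) would be prime to p^k and divide [d] by Gauss, so |g(m)| <=
   d. *)
rewrite dvdzE; apply: contraLR d_lt => p_g; rewrite -leqNgt dvdn_leq //.
rewrite -(@Gauss_dvdr _ (p ^ k)).
  by rewrite -f_m fgh hornerM abszM dvdn_mulr.
by rewrite coprime_sym coprimeXl // prime_coprime.
Qed.

(* The hypothesis [1 + height f <= m] makes the base of the power nonnegative.
   It follows from the next one when D is odd; when D is even the statement
   fails without it: f = z^4 + z^2 + 1 = (z^2 + z + 1)(z^2 - z + 1), D = 2,
   m = k = d = 1, p = 3. *)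
Theorem theorem4 (f : {poly int}) (D m d k p : nat)
  (f_prim : primitive_poly f)
  (f_coef : f`_0 * lead_coef f != 0)
  (D_gt0 : (0 < D)%N)
  (D_bound : factor_degree_bound f D)
  (p_prime : prime p)
  (p_ndvd_d : ~~ (p %| d)%N)
  (m_ge : 1 + height f <= m%:R)
  (m_pow : d%:R <= (m%:R - 1 - height f) ^+ D)
  (f_m : (f^`N(0)).[m%:Z] = (p ^ k * d)%N%:Z \/
         (f^`N(0)).[m%:Z] = - (p ^ k * d)%N%:Z) :
  (exists gs : seq {poly int},
     [/\ forall g, g \in gs -> irreducible_elt g,
         f = \prod_(g <- gs) g &
         (((size gs)%:Z)%:E <= min_index_valuation p f m)%E]) /\
  (k = 1%N \/ ~~ (p%:Z %| (f^`N(1)).[m%:Z])%Z -> irreducible_elt f).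
Proof.
have f0 : f != 0 by apply: contra_neq f_coef => ->; rewrite lead_coef0 mulr0.
have f_gt1 : (1 < size f)%N.
  by case: D_bound => le_Df _; rewrite -ltn_predRL; exact: leq_trans le_Df.
have d_gt0 : (0 < d)%N by case: d p_ndvd_d {m_pow f_m} => //; rewrite dvdn0.
rewrite nderivn0 in f_m.
have {}f_m : absz f.[m%:Z] = (p ^ k * d)%N.
  by case: f_m => ->; rewrite ?abszN absz_nat.
have uf := primitive_poly_zcontents_unit f0 f_prim.
have [gs [irr_gs fE]] := primitive_factorization uf f_gt1.
have p_gs g : g \in gs -> (p%:Z %| g.[m%:Z])%Z.
  move=> g_gs; have [_ g_gt1] := irr_gs g g_gs.
  have p_dvd := prime_dvd_factor_horner f0 D_gt0 D_bound p_prime p_ndvd_d.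
  apply: (p_dvd _ _ _ _ m_ge m_pow f_m _ g_gt1).
  by rewrite fE (big_rem g).
(* Substituting X + m in each factor turns g(m) into its constant coefficient. *)
have p_f i : (p%:Z ^+ (size gs - i) %| (f^`N(i)).[m%:Z])%Z.
  rewrite -coef_comp_XaddC fE rmorph_prod -(big_map _ predT id).
  rewrite -(size_map (comp_poly ('X + m%:Z%:P)) gs).
  apply: coef_prod_dvdz => _ /mapP[g g_gs ->].
  by rewrite coef_comp_XaddC nderivn0 p_gs.
split.
  exists gs; split=> // [g /irr_gs[]//|].
  apply: le_bigmin => [|i _]; first exact: leey.
  (* A vanishing s_i(m) contributes [+oo]; otherwise the divisibility says that r - i is at most its
     valuation, where r is [size gs]. *)
  rewrite /vp; case: eqP => [_|/eqP s_i]; first by rewrite addey // leey.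
  rewrite -EFinD lee_fin -PoszD lez_nat -leq_subLR.
  by rewrite -pfactor_dvdn ?absz_gt0 // -[p in (p ^ _)%N]absz_nat -abszX -dvdzE.
move=> k1_or; have gs_le1 : (size gs <= 1)%N.
  case: k1_or => [k1|].
    (* For i = 0, p^r divides p d, whose valuation at [p] is 1. *)
    have := p_f 0%N; rewrite nderivn0 dvdzE abszX absz_nat f_m subn0 k1 expn1.
    rewrite pfactor_dvdn ?muln_gt0 ?d_gt0 ?prime_gt0 //.
    rewrite lognM ?d_gt0 ?prime_gt0 //.
    by rewrite logn_prime // eqxx logn_coprime ?prime_coprime // addn0.
  (* If r > 1, the case i = 1 gives that [p] divides s_1(m). *)
  move=> s1_ndvd; rewrite leqNgt; apply: contra s1_ndvd => gs_gt1.
  apply: dvdz_trans (p_f 1%N).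
  by rewrite -[X in (X %| _)%Z]expr1 dvdz_exp2l // subn_gt0.
(* The empty product is excluded because [f] is nonconstant. *)
case: gs gs_le1 fE irr_gs {p_gs p_f} => [|g []] // _ fE irr_gs.
  by move: f_gt1; rewrite fE big_nil size_poly1.
by rewrite fE big_seq1; case: (irr_gs g _) => //; exact: mem_head.
Qed.
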